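(* Let $\mathcal{C}$ be a crystal framework in $\mathbb{R}^d$ with full rank translation group $\mathcal{T}$, motif $(F_v,F_e)$ and RUM spectrum $\Omega(\mathcal{C})\subseteq\mathbb{T}^d$. For a positive integer $n$ let $r=(n,\dots,n)$, let $\nu_n=\dim\ker R^{(r)}$ be the nullity of the rigidity transformation for $n$-fold periodicity, and let $\mathbb{T}^d_r=\{(e^{2\pi ik_1/n},\dots,e^{2\pi ik_d/n}):0\le k_i\le n-1\}$. Then (i) $d-1+|\Omega(\mathcal{C})\cap\mathbb{T}^d_r|\le\nu_n\le d|F_v|\,|\Omega(\mathcal{C})\cap\mathbb{T}^d_r|$, where $|F_v|$ is the number of vertices of the motif; (ii) if there are $c>0$ and $\alpha>0$ with $\nu_n\ge cn^\alpha$ for all positive integers $n$, then $\dim\Omega(\mathcal{C})\ge\alpha$.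
   Context: A full rank translation group is $\mathcal{T}=\{T_k:k\in\mathbb{Z}^d\}$, $T_kx=x+\sum_ik_ia_i$, $a_1,\dots,a_d$ linearly independent. A crystal framework $\mathcal{C}$ in $\mathbb{R}^d$ with finite motif $(F_v,F_e)$ is a connected bar-joint framework with vertices $p_{\kappa,k}=T_kp_{\kappa,0}$ ($\kappa\in\{1,\dots,|F_v|\}$, $k\in\mathbb{Z}^d$), $F_v=\{p_{\kappa,0}\}$, $F_e$ a finite set of edges each with a vertex in $F_v$, and edge set the disjoint union of the $T_k(F_e)$. The rigidity matrix $R(\mathcal{C})$ maps displacement vectors $u=(u_{\kappa,k})$ ($u_{\kappa,k}\in\mathbb{R}^d$ or $\mathbb{C}^d$) to bond sequences indexed by the edges $T_ke$ ($e\in F_e$, $k\in\mathbb{Z}^d$) via $(R(\mathcal{C})u)_{[p_{\kappa,k},p_{\tau,l}]}=\sum_\sigma(p_{\kappa,k}-p_{\tau,l})_\sigma((u_{\kappa,k})_\sigma-(u_{\tau,l})_\sigma)$. For $r=(r_1,\dots,r_d)$, $R^{(r)}$ is the restriction of $R(\mathcal{C})$ to $r$-periodic displacement vectors ($u_{\kappa,k+m}=u_{\kappa,k}$ whenever $r_i\mid m_i$ for all $i$), mapping into $r$-periodic bond sequences. For $\omega\in\mathbb{T}^d$, $R^\omega$ is the restriction of $R(\mathcal{C})$ to the space of complex displacement vectors with $u_{\kappa,k}=\omega^ku_{\kappa,0}$ ($\omega^k=\prod\omega_i^{k_i}$). The RUM spectrum is $\Omega(\mathcal{C})=\{\omega\in\mathbb{T}^d:\ker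 R^\omega\ne\{0\}\}$; it is a real algebraic subvariety of $\mathbb{T}^d$ and $\dim\Omega(\mathcal{C})$ denotes its real dimension. *)

(* Defs.v *)
From Stdlib Require Import Relation_Operators.
From HB Require Import structures.
From mathcomp Require Import all_boot all_order all_algebra finmap.
From mathcomp Require Import boolp classical_sets functions cardinality.
From mathcomp Require Import reals constructive_ereal ereal exp trigo.
From mathcomp Require Import complex.
(* Without its notations, which clash with those of the analysis library. *)
From mathcomp Require Import -(notations) mpoly.

Set Implicit Arguments.
Unset Strict Implicit.
Unset Printing Implicit Defensive.

Import Order.TTheory GRing.Theory Num.Theory.

Local Open Scope classical_set_scope.
Local Open Scope ring_scope.

Section Dimension.
Variables (K : fieldType) (E : lmodType K).

Definition is_basis (S : set E) (n : nat) (v : 'I_n -> E) : Prop :=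
  [/\ forall i, S (v i),
      forall c : 'I_n -> K, \sum_i c i *: v i = 0 -> forall i, c i = 0
    & forall x, S x -> exists c : 'I_n -> K, x = \sum_i c i *: v i].

(* The junk value 0 is taken when the subspace [S] has no finite basis. *)
Definition vdim (S : set E) : nat :=
  xget 0%N [set n | exists v : 'I_n -> E, is_basis S v].

End Dimension.

(* Krull dimension of A/I: the supremum of the lengths k of the chains
   P_0 < ... < P_k of prime ideals of A that contain I.  It is -oo if there
   is none. *)
Definition krull_dim_mod (R : realType) (A : comNzRingType) (I : set A) :
    \bar R :=
  ereal_sup [set k%:R%:E | k in [set k : nat |
    exists P : 'I_k.+1 -> prime_idealr A,
      [/\ forall i x, I x -> x \in P i,
          forall i j : 'I_k.+1, (i < j)%N -> {subset P i <= P j}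
        & forall i j : 'I_k.+1, (i < j)%N ->
            exists2 x, x \in P j & x \notin P i]]].

Definition vanishing_ideal (R : realType) (m : nat) (S : set ('I_m -> R)) :
    set (mpoly m R) :=
  [set f | forall x, S x -> meval x f = 0].

(* The dimension of a real algebraic set S of R^m is the Krull dimension of
   its ring of polynomial functions R[X_1, ..., X_m] / I(S). *)
Definition real_alg_dim (R : realType) (m : nat) (S : set ('I_m -> R)) :
    \bar R :=
  krull_dim_mod R (vanishing_ideal S).

(* C^d as R^(2d): (Re z_1, ..., Re z_d, Im z_1, ..., Im z_d). *)
Definition real_coords (R : realType) (d : nat) (z : 'rV[R[i]]_d) :
    'I_(d + d) -> R :=
  row_mx (map_mx (@complex.Re R) z) (map_mx (@complex.Im R) z) 0.

(* Framework vertices are labelled by (kappa, k), with kappa the index of a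
   motif vertex and k in Z^d. *)
Definition vertex (d nv : nat) : Type := ('I_nv * 'rV[int]_d)%type.

Definition vshift d nv (k : 'rV[int]_d) (x : vertex d nv) : vertex d nv :=
  (x.1, x.2 + k).

(* Edges are unordered: an edge is represented by one of its two orientations,
   and [same_edge] identifies the two. *)
Definition eshift d nv (k : 'rV[int]_d) (e : vertex d nv * vertex d nv) :=
  (vshift k e.1, vshift k e.2).

Definition same_edge d nv (e f : vertex d nv * vertex d nv) : Prop :=
  e = f \/ e = (f.2, f.1).

(* The translation vectors a_1, ..., a_d are the rows of [A]. *)
Definition translate (R : realType) d (A : 'M[R]_d) (k : 'rV[int]_d)
    (x : 'rV[R]_d) : 'rV[R]_d :=
  x + \sum_i (k 0 i)%:~R *: row i A.

Record crystal_framework (R : realType) (d : nat) := CrystalFramework {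
  lattice : 'M[R]_d;
  lattice_free : row_free lattice;
  motif_size : nat;
  motif_size_gt0 : (0 < motif_size)%N;
  motif_point : 'I_motif_size -> 'rV[R]_d;
  position : vertex d motif_size -> 'rV[R]_d :=
    fun x => translate lattice x.2 (motif_point x.1);
  position_inj : injective position;
  motif_edges : nat;
  motif_edge : 'I_motif_edges -> vertex d motif_size * vertex d motif_size;
  motif_edge_meets : forall e,
    (motif_edge e).1.2 = 0 \/ (motif_edge e).2.2 = 0;
  motif_edge_neq : forall e, (motif_edge e).1 <> (motif_edge e).2;
  (* T_k e and T_l f are the same edge only when e = f and k = l. *)
  motif_edge_disjoint : forall e f k l,
    same_edge (eshift k (motif_edge e)) (eshift l (motif_edge f)) ->
    e = f /\ k = l;
  framework_connected : forall v w,
    clos_refl_trans _ (fun x y => exists e k,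
      same_edge (x, y) (eshift k (motif_edge e))) v w
}.

Section Rigidity.
Variables (R : realType) (d : nat) (F : crystal_framework R d).

Definition bond : Type := ('I_(motif_edges F) * 'rV[int]_d)%type.

(* Displacement vectors over a field extension [K] of [R], through [iota]. *)
Definition displacement (K : fieldType) : Type :=
  vertex d (motif_size F) -> 'rV[K]_d.

(* Exchanging the two ends of an edge does not change the value at the bond. *)
Definition rigidity (K : fieldType) (iota : {rmorphism R -> K})
    (u : displacement K) : bond -> K :=
  fun b => let e := eshift b.2 (motif_edge b.1) in
    \sum_s iota ((position e.1 - position e.2) 0 s) * (u e.1 0 s - u e.2 0 s).

Definition periodic (r : 'I_d -> nat) (K : fieldType) (u : displacement K) :=
  forall m : 'rV[int]_d, (forall i, ((r i)%:Z %| m 0%R i)%Z) ->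
  forall kappa k, u (kappa, k + m) = u (kappa, k).

(* Real displacement vectors.  Their bond sequences are r-periodic, so the
   restricted codomain plays no role in the kernel. *)
Definition periodic_kernel (r : 'I_d -> nat) :
    set (vertex d (motif_size F) -> 'rV[R]_d) :=
  [set u | periodic r u /\ forall b, rigidity idfun u b = 0].

Definition torus : set 'rV[R[i]]_d :=
  [set omega : 'rV[R[i]]_d | forall i, `|omega 0 i| = 1].

Definition phase_periodic (omega : 'rV[R[i]]_d) (u : displacement R[i]) :=
  forall kappa k, u (kappa, k) = (\prod_i omega 0 i ^ k 0 i) *: u (kappa, 0).

Definition phase_kernel (omega : 'rV[R[i]]_d) : set (displacement R[i]) :=
  [set u | phase_periodic omega u /\
           forall b, rigidity (real_complex R) u b = 0].

Definition RUM_spectrum : set 'rV[R[i]]_d :=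
  [set omega | torus omega /\
     exists2 u, phase_kernel omega u & exists x, u x <> 0].

Definition RUM_dim : \bar R :=
  real_alg_dim [set real_coords omega | omega in RUM_spectrum].

End Rigidity.

Arguments periodic_kernel {R d} F r.
Arguments phase_kernel {R d} F omega.

Definition torus_grid (R : realType) (d : nat) (r : 'I_d -> nat) :
    set 'rV[R[i]]_d :=
  [set omega : 'rV[R[i]]_d | exists2 k : 'I_d -> nat, forall i, (k i < r i)%N &
     forall i, let theta := 2 * pi * (k i)%:R / (r i)%:R in
       omega 0 i = Complex (cos theta) (sin theta)].

Arguments torus_grid R {d} r.

(* Main.v *)
Require Import Defs.
From HB Require Import structures.
From mathcomp Require Import all_boot all_order all_algebra finmap.
From mathcomp Require Import boolp classical_sets functions cardinality.
From mathcomp Require Import reals constructive_ereal ereal exp trigo.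
From mathcomp Require Import complex.
From mathcomp Require Import ring lra.
From mathcomp Require Import -(notations) mpoly.
From mathcomp Require lebesgue_measure.

Set Implicit Arguments.
Unset Strict Implicit.
Unset Printing Implicit Defensive.

Import Order.TTheory GRing.Theory Num.Theory.

Local Open Scope classical_set_scope.
Local Open Scope ring_scope.

(** The finite Fourier transform splits the complexified kernel of R^(r) into
    the kernels of R^w for the n-torsion points w: each one met by the spectrum
    contributes between 1 and d|F_v| dimensions, and w = 1 contributes at least
    d by the translations.  This is (i), and it reduces (ii) to bounding the
    number of points of S = Omega(C) on a grid of R^(2d) with O(n) values per
    coordinate by O(n^k) for some k <= dim S.  Let J be a largest set of
    variables such that no nonzero polynomial function of these variables
    vanishes on S, and k = |J|.  Every larger set of variables carries a
    nonzero polynomial vanishing on S; reducing modulo the leading monomials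
    of these polynomials and of the grid polynomials shows that the functions
    on the grid points of S are spanned by O(n^k) monomials.  Conversely a
    prime ideal meeting R[X_J] trivially can be enlarged by X_j - c for a
    suitable real c so that it still meets R[X_(J - j)] trivially, so there is
    a chain of k + 1 primes containing I(S). *)

(** * Grid points and standard monomials *)

(** The hypothesis makes the rows of the matrix [phi] independent, so its rank is [#|I|], which the
    number of columns bounds. *)
Lemma leq_card_coords (K : fieldType) (I J : finType) (phi : I -> J -> K) :
  (forall c : I -> K, (forall j, \sum_i c i * phi i j = 0) ->
     forall i, c i = 0) ->
  (#|I| <= #|J|)%N.
Proof.
move=> phi_inj; pose A := \matrix_(i < #|I|, j < #|J|)
  phi (enum_val i) (enum_val j).
suff /eqP <- : row_free A by exact: rank_leq_col.
apply: inj_row_free => v vA0; apply/rowP => i; rewrite mxE -(enum_valK i).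
apply: (phi_inj (fun x => v 0 (enum_rank x))) => j.
have := congr1 (fun B : 'rV_ _ => B 0 (enum_rank j)) vA0.
rewrite !mxE => vA; rewrite -[RHS]vA (reindex (@enum_val I predT)) /=;
  last first.
  by apply: onW_bij; exact: enum_val_bij.
by apply: eq_bigr => k _; rewrite mxE enum_valK enum_rankK.
Qed.

Section StandardMonomials.
Variables (K : fieldType) (m : nat).
Local Notation pol := (mpoly m K).
Local Notation ev := (@meval m K).
Local Notation mon := (@mpolyX m K).

Definition supported (J : {set 'I_m}) (u : multinom m) :=
  forall i, i \notin J -> u i = 0%N.

Section Points.
Variables (T : finType) (p : T -> 'I_m -> K) (c : T -> K).
Let Lam (f : pol) := \sum_a c a * ev (p a) f.

(** [Lam] kills the multiple of [g] with leading monomial [u], since [g] vanishes at all the points;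
    the other monomials of that multiple are smaller and are killed by assumption. *)
Lemma weighted_sum_reduce (g : pol) (u : multinom m) :
  g != 0 -> (forall a, ev (p a) g = 0) -> lem (mlead g) u ->
  (forall v, (v < u)%O -> Lam (mon v) = 0) -> Lam (mon u) = 0.
Proof.
move=> g0 gp /mnm_lepP gu IH.
have LamD : {morph Lam : f h / f + h}.
  move=> f h; rewrite /Lam -big_split /=; apply: eq_bigr => a _.
  by rewrite mevalD mulrDr.
have LamZ l f : Lam (l *: f) = l * Lam f.
  by rewrite /Lam mulr_sumr; apply: eq_bigr => a _; rewrite mevalZ mulrCA.
have Lam0 : Lam 0 = 0.
  by rewrite /Lam big1 // => a _; rewrite meval0 mulr0.
pose h := g * mon (mnm_sub u (mlead g)).
have X0 : mon (mnm_sub u (mlead g)) != 0 by rewrite -msupp_eq0 msuppX.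
have hlead : mlead h = u.
  rewrite mleadM // mleadXm; apply/mnmP => i.
  by rewrite mnmDE mnmBE subnKC.
have h0 : h != 0 by rewrite mulf_neq0.
have Lamh : Lam h = 0.
  by rewrite /Lam big1 // => a _; rewrite mevalM gp mul0r mulr0.
have := Lamh; rewrite {1}(mpolyE h) (big_morph _ LamD Lam0).
rewrite (bigD1_seq u) ?msupp_uniq //=; last by rewrite -hlead mlead_supp.
rewrite [X in _ + X]big1_seq ?addr0 => [|v /andP[vu vh]].
  rewrite LamZ => /eqP; rewrite mulf_eq0 => /orP[|/eqP//].
  by rewrite -hlead mleadc_eq0 (negPf h0).
rewrite LamZ IH ?mulr0 // lt_neqAle vu -hlead.
exact: msupp_le_mlead.
Qed.

End Points.

Definition grid_poly (G : seq K) (i : 'I_m) : pol :=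
  \prod_(x <- G) (mon (mnm1 i) - mpolyC m x).

Lemma mlead_varB (i : 'I_m) (x : K) :
  mlead (mon (mnm1 i) - mpolyC m x) = mnm1 i.
Proof.
rewrite mleadDl ?mleadXm // mleadN mleadC.
by rewrite lt_neqAle le0x andbT eq_sym mnm1_eq0.
Qed.

Lemma varB_neq0 (i : 'I_m) (x : K) : mon (mnm1 i) - mpolyC m x != 0.
Proof.
apply/eqP => /(congr1 (fun f => mlead f i)); rewrite mlead_varB mlead0.
by rewrite mnm1E mnm0E eqxx.
Qed.

Lemma grid_poly_neq0 G i : grid_poly G i != 0.
Proof.
rewrite /grid_poly; elim: G => [|x G IH]; first by rewrite big_nil oner_neq0.
by rewrite big_cons mulf_neq0 ?varB_neq0.
Qed.

Lemma mlead_grid_poly G i j : mlead (grid_poly G i) j = ((i == j) * size G)%N.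
Proof.
elim: G => [|x G IH]; first by rewrite /grid_poly big_nil mlead1 mnm0E muln0.
have -> : grid_poly (x :: G) i = (mon (mnm1 i) - mpolyC m x) * grid_poly G i.
  by rewrite /grid_poly big_cons.
rewrite mleadM ?varB_neq0 ?grid_poly_neq0 // mlead_varB mnmDE IH mnm1E.
by rewrite mulnS.
Qed.

Lemma grid_poly_eval G i z : z i \in G -> ev z (grid_poly G i) = 0.
Proof.
rewrite /grid_poly; elim: G => // x G IH; rewrite inE big_cons mevalM.
case/orP => [/eqP <-|/IH ->]; last by rewrite mulr0.
by rewrite mevalB mevalXU mevalC subrr mul0r.
Qed.

(** A product over [b] of factors [X_i - p b i], with [i] a coordinate in which [a] and [b]
    differ. *)
Lemma separating_poly (T : finType) (p : T -> 'I_m -> K) :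
  (forall a b, a != b -> exists i, p a i != p b i) ->
  forall a, exists f : pol, ev (p a) f != 0 /\
    forall b, b != a -> ev (p b) f = 0.
Proof.
move=> p_sep a.
have sep b : exists f : pol, ev (p a) f != 0 /\ (b != a -> ev (p b) f = 0).
  have [->|ba] := eqVneq b a; first by exists 1; rewrite meval1 oner_neq0.
  have [i pi] := p_sep _ _ ba.
  exists (mon (mnm1 i) - mpolyC m (p b i)).
  by rewrite !mevalB !mevalXU !mevalC subrr subr_eq0 eq_sym.
have /fin_all_exists[f fP] := sep; exists (\prod_b f b); split.
  rewrite (big_morph _ (@mevalM m K (p a)) (@meval1 m K (p a))).
  by apply/prodf_neq0 => b _; case: (fP b).
move=> b ba; rewrite (big_morph _ (@mevalM m K (p b)) (@meval1 m K (p b))).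
by rewrite (bigD1 b) //= (fP b).2 ?mul0r.
Qed.

Definition large_coords (D : nat) (u : 'I_m -> nat) : {set 'I_m} :=
  [set i | (D <= u i)%N].

(** There are at most [2 ^ m] choices for the set [T] of large coordinates. For fixed [T], a
    coordinate outside [T] takes at most [D] values, and each of the at most [k] coordinates in [T]
    takes [b]. *)
Lemma card_small_support (b D k : nat) : (0 < b)%N -> (0 < D)%N ->
  (#|[set u : {ffun 'I_m -> 'I_b} | #|large_coords D (fun i => u i)| <= k]%SET|
    <= 2 ^ m * D ^ m * b ^ k)%N.
Proof.
move=> b0 D0; set B := [set u | _]%SET.
pose Fam (T : {set 'I_m}) (i : 'I_m) : {set 'I_b} :=
  if i \in T then finset.setT else [set x : 'I_b | (x < D)%N]%SET.
have cardF (T : {set 'I_m}) : (#|T| <= k)%N ->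
    (#|family (Fam T)| <= D ^ m * b ^ k)%N.
  move=> Tk; rewrite card_family foldrE big_map big_enum /=.
  apply: (@leq_trans (\prod_(i : 'I_m) (D * (if i \in T then b else 1)))%N).
    apply: leq_prod => i _; rewrite /Fam; case: ifP => _.
      by rewrite cardsT card_ord leq_pmull.
    rewrite muln1; set A := [set _ | _]%SET.
    have [bD|/ltnW Db] := leqP b D.
      by apply: leq_trans bD; rewrite -[leqRHS]card_ord max_card.
    have wI : injective (widen_ord Db) by move=> x y [] /val_inj.
    rewrite -[leqRHS]card_ord -(card_imset _ wI).
    apply/subset_leq_card/fintype.subsetP => x; rewrite inE => xD.
    by apply/imsetP; exists (Ordinal xD) => //; apply/val_inj.
  rewrite big_split /= prod_nat_const card_ord leq_mul2l.
  apply/orP; right; rewrite -big_mkcond /= prod_nat_const.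
  by rewrite leq_pexp2l.
rewrite -mulnA -[X in (2 ^ X)%N]card_ord -cardsT -card_powerset.
apply: (@leq_trans #|\bigcup_(T in powerset [set: 'I_m]%SET | (#|T| <= k)%N)
    [set u in family (Fam T)]%SET|).
  apply/subset_leq_card/fintype.subsetP => u; rewrite inE => uk.
  apply/bigcupP; exists (large_coords D (fun i => u i)).
    by rewrite powersetE finset.subsetT.
  rewrite inE; apply/familyP => i; rewrite /Fam !inE.
  by case: ifP; rewrite ?inE // ltnNge => ->.
apply: (@leq_trans (\sum_(T in powerset [set: 'I_m]%SET | (#|T| <= k)%N)
   (D ^ m * b ^ k))%N).
  elim/big_rec2: _ => [|T y B' /andP[_ Tk] IH]; first by rewrite cards0.
  apply: leq_trans (leq_card_setU _ _) _; rewrite leq_add //.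
  by rewrite cardsE cardF.
rewrite big_mkcondr /=.
rewrite -sum_nat_const leq_sum // => T _; by case: ifP.
Qed.

(* A linear functional on the functions on the grid points that kills the
   standard monomials kills all monomials, by induction on the monomial order;
   a standard monomial has at most [k] exponents above the fixed bound [D]. *)
Lemma card_grid_points (S : set ('I_m -> K)) (k : nat) :
  (forall J : {set 'I_m}, (k < #|J|)%N -> exists2 f : pol, f != 0 &
     (forall x, S x -> ev x f = 0) /\ supported J (mlead f)) ->
  exists C : nat, forall (G : seq K) (T : finType) (p : T -> 'I_m -> K),
    (0 < size G)%N ->
    (forall a, S (p a)) -> (forall a i, p a i \in G) ->
    (forall a b, a != b -> exists i, p a i != p b i) ->
    (#|T| <= C * size G ^ k)%N.
Proof.
move=> dep.
have dep' (J : {set 'I_m}) : exists f : pol, (k < #|J|)%N ->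
    [/\ f != 0, forall x, S x -> ev x f = 0 & supported J (mlead f)].
  have [|_] := ltnP k #|J|; last by exists 0.
  by move=> /dep[f ? []]; exists f.
have {dep dep'} /fin_all_exists[f fP] := dep'.
(* [D] bounds all exponents of the chosen leading monomials; the successor makes it positive for
   [card_small_support]. *)
pose D := (\max_(J : {set 'I_m}) \max_(i : 'I_m) mlead (f J) i).+1.
have leD J i : (mlead (f J) i <= D)%N.
  apply/leqW/(leq_trans _ (leq_bigmax J)).
  exact: (leq_bigmax (F := fun i => mlead (f J) i) i).
exists (2 ^ m * D ^ m)%N => G T p G0 pS pG p_sep.
apply: leq_trans (@card_small_support (size G) D k G0 isT).
set B := [set u : {ffun _ -> _} | _]%SET.
pose e (u : {ffun 'I_m -> 'I_(size G)}) : multinom m :=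
  Multinom [tuple nat_of_ord (u i) | i < m].
have eE u i : e u i = u i by rewrite multinomE tnth_mktuple.
rewrite -[leqRHS]card_sig; pose St : finType := {u | u \in B}.
apply: (@leq_card_coords K T St (fun a u => ev (p a) (mon (e (val u))))).
move=> c cP.
have c0 u : \sum_a c a * ev (p a) (mon u) = 0.
  elim/(ltmwf (n := m)): u => u IH.
  have [[i iG]|small] := pselect (exists i, size G <= u i)%N.
    apply: (@weighted_sum_reduce T p c (grid_poly G i)) => //.
    - exact: grid_poly_neq0.
    - by move=> a; rewrite grid_poly_eval.
    - apply/mnm_lepP => j; rewrite mlead_grid_poly.
      by case: eqP => [<-|_]; rewrite ?mul1n.
  have uG i : (u i < size G)%N.
    by rewrite ltnNge; apply/negP => ?; apply: small; exists i.
  pose v := [ffun i => Ordinal (uG i)] : {ffun 'I_m -> 'I_(size G)}.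
  have ev_u : e v = u by apply/mnmP => i; rewrite eE ffunE.
  have [vB|vB] := boolP (v \in B).
    by have := cP (Sub v vB); rewrite /= ev_u.
  (* More than [k] exponents of [u] are at least [D]. For the set [J] of their positions, the
     leading monomial of [f J] is supported in [J] with exponents at most [D], so it divides [u]. *)
  move: vB; rewrite inE -ltnNge => /fP[f0 fS fJ].
  apply: (@weighted_sum_reduce T p c (f (large_coords D (fun i => v i)))) => //.
    by move=> a; apply: fS.
  apply/mnm_lepP => i.
  have [|/fJ -> //] := boolP (i \in large_coords D (fun i => v i)).
  by rewrite inE ffunE; apply: leq_trans.
(* The weighted sum now vanishes on all polynomials, and a polynomial separating [a] from the other
   points isolates [c a]. *)
move=> a; have [h [ha hb]] := separating_poly p_sep a.
have : \sum_b c b * ev (p b) h = 0.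
  rewrite (mpolyE h).
  under eq_bigr => b _ do rewrite raddf_sum mulr_sumr.
  rewrite exchange_big big1 //= => u _.
  under eq_bigr => b _ do rewrite mevalZ mulrCA.
  by rewrite -mulr_sumr c0 mulr0.
rewrite (bigD1 a) //= big1 ?addr0; last by move=> b /hb ->; rewrite mulr0.
by move/eqP; rewrite mulf_eq0 (negPf ha) orbF => /eqP.
Qed.

End StandardMonomials.

(** * Chains of prime ideals *)

(** A countable union of finite fibers would be countable, whereas the unit interval has positive
    Lebesgue measure. *)
Lemma exists_infinite_fiber (R : realType) (g : R -> nat) :
  exists D, infinite_set [set c | g c = D].
Proof.
apply: contrapT => /forallNP fin.
have cR : countable [set: R].
  have -> : [set: R] = \bigcup_(D in [set: nat]) [set c | g c = D].
    by apply/seteqP; split => // x _; exists (g x).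
  apply: bigcup_countable => [|D _]; first exact: countableP.
  by apply: finite_set_countable; apply: contrapT; exact: fin.
have := lebesgue_measure.countable_lebesgue_measure0
  (sub_countable (subset_card_le (@subsetT _ [set` `[0 : R, 1]])) cR).
rewrite lebesgue_measure.lebesgue_measure_itv /= lte_fin ltr01 sube0.
by move/eqP; rewrite eqe oner_eq0.
Qed.

Section Chains.
Variables (R : realType) (m : nat).
Local Notation pol := (mpoly m R).
Local Notation ev := (@meval m R).
Local Notation varB j c := (mpolyX R (mnm1 j) - mpolyC m c : mpoly m R).

(* Membership in R[X_J] is expressed through the values of [f], which is
   harmless since vanishing ideals only see values. *)
Definition depends_on (J : {set 'I_m}) (f : pol) :=
  forall x y, (forall i, i \in J -> x i = y i) -> ev x f = ev y f.

(** Algebraic independence modulo [Q] of the variables in [J]. It also makes an ideal proper, since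
    the constant 1 depends on no variable. *)
Definition free_mod (J : {set 'I_m}) (Q : set pol) :=
  forall f, Q f -> depends_on J f -> forall x, ev x f = 0.

Definition ideal_set (Q : set pol) :=
  Q 0 /\ forall a f g, Q f -> Q g -> Q (a * f + g).

Definition adjoin (Q : set pol) (g : pol) : set pol :=
  [set f | exists2 q, Q q & exists a, f = a * g + q].

Lemma adjoin_ideal Q g : ideal_set Q -> ideal_set (adjoin Q g).
Proof.
move=> [Q0 QD]; split; first by exists 0 => //; exists 0; rewrite mul0r addr0.
move=> a _ _ [q1 Q1 [b1 ->]] [q2 Q2 [b2 ->]].
exists (a * q1 + q2); first exact: QD.
by exists (a * b1 + b2); rewrite mulrDr mulrDl mulrA addrACA.
Qed.

Lemma sub_adjoin Q g : Q `<=` adjoin Q g.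
Proof. by move=> q Qq; exists q => //; exists 0; rewrite mul0r add0r. Qed.

Lemma adjoin_gen Q g : ideal_set Q -> adjoin Q g g.
Proof. by case=> Q0 _; exists 0 => //; exists 1; rewrite mul1r addr0. Qed.

Lemma exists_nonroot (q : {poly R}) : q != 0 -> exists t, q.[t] != 0.
Proof.
move=> q0; apply: contrapT => /forallNP rt.
pose rs := [seq k%:R : R | k <- iota 0 (size q)].
have : (size rs < size q)%N.
  apply: max_poly_roots => //.
    by apply/allP => t _; apply/rootP; apply/eqP/negPn/negP/rt.
  by rewrite map_inj_uniq ?iota_uniq // => a b /eqP; rewrite eqr_nat => /eqP.
by rewrite size_map size_iota ltnn.
Qed.

(* Restricting to the line through two points reduces this to {poly R}. *)
Lemma mul_nonvanishing (f g : pol) x y :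
  ev x f != 0 -> ev y g != 0 -> exists z, ev z (f * g) != 0.
Proof.
move=> fx gy; pose v i := (x i)%:P + (y i - x i) *: 'X.
pose h (p : pol) : {poly R} :=
  \sum_(u <- msupp p) (mcoeff u p)%:P * \prod_i v i ^+ u i.
have hE p t : (h p).[t] = ev (fun i => (v i).[t]) p.
  rewrite /h horner_sum mevalE; apply: eq_bigr => u _.
  rewrite hornerM hornerC horner_prod; congr (_ * _).
  by apply: eq_bigr => i _; rewrite horner_exp.
have hf : h f != 0.
  apply: contraNneq fx => hf0; rewrite -(@meval_eq _ _ (fun i => (v i).[0])).
    by rewrite -hE hf0 horner0.
  by move=> i; rewrite hornerD hornerC hornerZ hornerX mulr0 addr0.
have hg : h g != 0.
  apply: contraNneq gy => hg0; rewrite -(@meval_eq _ _ (fun i => (v i).[1])).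
    by rewrite -hE hg0 horner0.
  by move=> i; rewrite hornerD hornerC hornerZ hornerX mulr1 addrC subrK.
have [t] := exists_nonroot (mulf_neq0 hf hg).
by rewrite hornerM !hE -mevalM => ?; exists (fun i => (v i).[t]).
Qed.

(** Zorn's lemma gives an ideal [A] over [Q] that is maximal with [free_mod J]. If [u] and [v] lie
    outside [A], then [A + (u)] and [A + (v)] contain nonzero functions [d1] and [d2] of the
    variables in [J]. With [u * v] in [A], the product [d1 * d2] would lie in [A], against
    freeness. *)
Lemma free_mod_prime (J : {set 'I_m}) (Q : set pol) :
  ideal_set Q -> free_mod J Q ->
  exists P : prime_idealr pol,
    (forall f, Q f -> f \in P) /\ free_mod J [set f | f \in P].
Proof.
move=> [Q0 QD] QJ.
(* The empty chain has an empty union, hence containing [Q] is asked of nonempty sets only; the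
   maximal set is nonempty because [Q] itself is good. *)
pose good (A : set pol) := [/\ forall a f g, A f -> A g -> A (a * f + g),
  free_mod J A & A !=set0 -> Q `<=` A].
have [|A [[AD AJ AQ] Amax]] := @Zorn_bigcup pol good.
  move=> F Fgood Ftot; split.
  - move=> a f g [X FX Xf] [Y FY Yg].
    have [XY|YX] := Ftot _ _ FX FY.
      by exists Y => //; have [YD _ _] := Fgood _ FY; apply: YD => //; exact: XY.
    by exists X => //; have [XD _ _] := Fgood _ FX; apply: XD => //; exact: YX.
  - by move=> f [X FX Xf]; have [_ XJ _] := Fgood _ FX; exact: XJ.
  - move=> [f [X FX Xf]]; have [_ _ XQ] := Fgood _ FX.
    by apply: subset_trans (bigcup_sup FX); apply: XQ; exists f.
have A_neq0 : A !=set0.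
  have [A0|/eqP/set0P//] := pselect (A = set0).
  have Qgood : good Q by split=> // _; exact: subset_refl.
  have [] := Amax Q _ Qgood.
  by rewrite A0; split; [exact: sub0set|move=> QA; exact: (QA _ Q0)].
have {AQ} QA := AQ A_neq0; have A0 := QA _ Q0.
have Aideal : ideal_set A by [].
have adjoinP u : ~ A u -> exists d,
    [/\ adjoin A u d, depends_on J d & exists x, ev x d != 0].
  move=> Au; apply: contrapT => /forallNP no.
  apply: (Amax (adjoin A u)).
    by split; [exact: sub_adjoin|move=> /(_ _ (adjoin_gen u Aideal))].
  split; first by case: (adjoin_ideal u Aideal).
    move=> d dA dJ x; apply/eqP/negPn/negP => dx.
    by apply: (no d); split => //; exists x.
  by move=> _; apply: subset_trans QA _; exact: sub_adjoin.
pose P := fun f : pol => `[< A f >].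
have Pcl : idealr_closed P.
  split; first exact/asboolP.
    apply/asboolP => A1.
    have := AJ _ A1
      (fun x y _ => etrans (meval1 x) (esym (meval1 y))) (fun=> 0).
    by rewrite meval1 => /eqP; rewrite oner_eq0.
  by move=> a f g /asboolP fA /asboolP gA; apply/asboolP; apply: AD.
have Ppr : prime_idealr_closed P.
  move=> u v /asboolP uvA; rewrite -[_ || _]negbK negb_or; apply/negP.
  case/andP => /asboolPn/adjoinP[d1 [[q1 Aq1 [a1 e1]] d1J [x1 nz1]]].
  move=> /asboolPn/adjoinP[d2 [[q2 Aq2 [a2 e2]] d2J [x2 nz2]]].
  have [z /eqP] := mul_nonvanishing nz1 nz2; apply.
  apply: AJ => [|x y xy]; last by rewrite !mevalM (d1J x y) // (d2J x y).
  have -> : d1 * d2 = a1 * a2 * (u * v) + (d2 * q1 + (a1 * u * q2 + 0)).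
    rewrite e1 {1}e2 addr0 mulrDl mulrDr [q1 * _]mulrC -e2 -addrA.
    congr (_ + _); first by rewrite mulrACA.
    by rewrite addrC.
  exact: (AD _ _ _ uvA (AD _ _ _ Aq1 (AD _ _ _ Aq2 A0))).
pose Pp : prime_idealr pol := HB.pack P
  (isIdealr.Build pol P Pcl) (isPrimeIdealrClosed.Build pol P Ppr).
exists Pp; split => [f Qf|f fP]; first by apply/asboolP; exact: QA.
by apply: AJ; apply/asboolP.
Qed.

(* Otherwise every [c] gives [d_c = a_c (X_j - c) + q_c] nonzero in
   [J :\ j]; as R is uncountable, infinitely many [a_c] have the same degree
   and are thus linearly dependent, [\sum_t l_t a_t = 0].  Then
   [\sum_t l_t d_t \prod_(s != t) (X_j - s)] lies in [Q] and depends on [J]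
   only, hence vanishes; at [X_j = t] this says [l_t = 0]. *)
Lemma free_mod_specialize (J : {set 'I_m}) (Q : set pol) (j : 'I_m) :
  ideal_set Q -> free_mod J Q -> j \in J ->
  exists c, free_mod (J :\ j) (adjoin Q (varB j c)).
Proof.
move=> [Q0 QD] QJ jJ; apply: contrapT => /forallNP no.
have QM a f : Q f -> Q (a * f) by move=> Qf; rewrite -[_ * _]addr0; apply: QD.
have QS (T : finType) (F : T -> pol) : (forall t, Q (F t)) -> Q (\sum_t F t).
  move=> QF; elim/big_ind: _ => // f g Qf Qg.
  by rewrite -[f]mul1r; apply: QD.
have /choice[w wP] : forall c, exists w : pol * pol * ('I_m -> R),
    [/\ Q w.1.2, depends_on (J :\ j) (w.1.1 * varB j c + w.1.2)
      & ev w.2 (w.1.1 * varB j c + w.1.2) != 0].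
  move=> c; apply: contrapT => /forallNP now; apply: (no c).
  move=> d [q Qq [a ->]] dJ x; apply/eqP/negPn/negP => dx.
  by apply: (now (a, q, x)); split.
pose a c := (w c).1.1; pose q c := (w c).1.2; pose d c := a c * varB j c + q c.
have [D Dinf] := exists_infinite_fiber (fun c => msize (a c)).
have [B BD Bbig] := infinite_set_fset #|{: bmultinom m D}|.+1 Dinf.
have szB (t : B) : msize (a (val t)) = D by apply: BD; exact: valP.
have [l [l0 [t lt]]] : exists l : B -> R,
    (forall u : bmultinom m D, \sum_t l t * mcoeff (bmnm u) (a (val t)) = 0) /\
    exists t, l t != 0.
  apply: contrapT => /forallNP nol.
  suff : (#|{: B}| <= #|{: bmultinom m D}|)%N.
    by rewrite -cardfE leqNgt Bbig.
  apply: (@leq_card_coords R B (bmultinom m D)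
    (fun t u => mcoeff (bmnm u) (a (val t)))) => l lP t.
  apply/eqP/negPn/negP => lt.
  by apply: (nol l); split => //; exists t.
have la0 : \sum_t l t *: a (val t) = 0.
  apply/mpolyP => u; rewrite mcoeff0 raddf_sum /=.
  have [uD|uD] := ltnP (mdeg u) D.
    rewrite -[RHS](l0 (BMultinom uD)); apply: eq_bigr => s _.
    by rewrite mcoeffZ.
  apply: big1 => s _; rewrite mcoeffZ memN_msupp_eq0 ?mulr0 //.
  by apply: msize_mdeg_ge; rewrite szB.
pose Pi (t : B) := \prod_(s | s != t) varB j (val s).
pose F := \sum_t l t *: (d (val t) * Pi t).
have QF : Q F.
  (* The terms with the [a t] add up to their vanishing combination times the product of all
     [X_j - s]. *)
  have -> : F = \sum_t (l t *: Pi t) * q (val t).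
    have laP : \sum_t (l t *: a (val t)) * \prod_(s : B) varB j (val s) = 0.
      by rewrite -mulr_suml la0 mul0r.
    rewrite -[RHS]add0r -[X in _ = X + _]laP -big_split.
    apply: eq_bigr => s _ /=.
    rewrite /d mulrDl scalerDr; congr (_ + _).
      by rewrite (bigD1 s) //= -scalerAl mulrA.
    by rewrite -scalerAl mulrC.
  by apply: QS => s; apply: QM; case: (wP (val s)).
have FE x : ev x F =
    \sum_t l t * (ev x (d (val t)) * \prod_(s | s != t) (x j - val s)).
  rewrite /F raddf_sum /=; apply: eq_bigr => s _; rewrite mevalZ mevalM.
  congr (_ * (_ * _)); rewrite (big_morph _ (@mevalM m R x) (@meval1 m R x)).
  by apply: eq_bigr => s' _; rewrite mevalB mevalXU mevalC.
have dP s : depends_on (J :\ j) (d s) by case: (wP s).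
have FJ : depends_on J F.
  move=> x y xy; rewrite !FE (xy j) //; apply: eq_bigr => s _.
  by rewrite (dP _ x y) // => i; rewrite !inE => /andP[_ /xy].
(* The point where [d t] is nonzero, with coordinate [j] moved to [t]: [d t] ignores that
   coordinate, and every summand of [F] but the one of [t] vanishes there. *)
pose x i := if i == j then val t else (w (val t)).2 i.
have := QJ F QF FJ x; rewrite FE (bigD1 t) //= [X in _ + X]big1 ?addr0;
  last first.
  move=> s st; rewrite (bigD1 t) /= 1?eq_sym //.
  by rewrite /x eqxx subrr mul0r !mulr0.
move/eqP; rewrite mulf_eq0 (negPf lt) mulf_eq0 /= => /orP[].
  rewrite (dP _ x (w (val t)).2); first by apply/negP; case: (wP (val t)).
  by move=> i; rewrite !inE /x => /andP[/negPf ->].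
apply/negP/prodf_neq0 => s st; rewrite /x eqxx subr_eq0.
by apply: contra st => /eqP/val_inj ->.
Qed.

(** By induction a chain of primes lies over [P0 + (X_j - c)], with one variable fewer. The prime
    [P0] goes below it: being free in [J], it does not contain [X_j - c]. *)
Lemma free_mod_chain (k : nat) (J : {set 'I_m}) (Q : set pol) :
  #|J| = k -> ideal_set Q -> free_mod J Q ->
  exists P : 'I_k.+1 -> prime_idealr pol,
    [/\ forall i x, Q x -> x \in P i,
        forall i j : 'I_k.+1, (i < j)%N -> {subset P i <= P j}
      & forall i j : 'I_k.+1, (i < j)%N ->
          exists2 x, x \in P j & x \notin P i].
Proof.
elim: k J Q => [|k IH] J Q Jk Qid QJ;
    have [P0 [QP0 P0J]] := free_mod_prime Qid QJ.
  by exists (fun=> P0); split=> [i x /QP0//|i j|i j]; rewrite !ord1.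
have [j jJ] : exists j, j \in J by apply/card_gt0P; rewrite Jk.
have P0id : ideal_set [set f | f \in P0].
  split; first exact: idealr0.
  by move=> a f g fP gP; rewrite /= rpredD // idealMr.
have [c cP] := free_mod_specialize P0id P0J jJ.
have cardJ : #|J :\ j| = k by move: Jk; rewrite (cardsD1 j) jJ => -[].
have [P [QP Pmon Pstr]] := IH _ _ cardJ (adjoin_ideal _ P0id) cP.
have P0P i : {subset P0 <= P i} by move=> x xP0; apply/QP/sub_adjoin.
have varP i : varB j c \in P i by apply/QP/adjoin_gen.
have varP0 : varB j c \notin P0.
  have vJ : depends_on J (varB j c).
    by move=> x y xy; rewrite !mevalB !mevalXU !mevalC xy.
  apply/negP => vP0; have := P0J _ vP0 vJ (fun=> c + 1).
  by rewrite mevalB mevalXU mevalC addrAC subrr add0r => /eqP; rewrite oner_eq0.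
pose Pk i := if unlift ord0 i is Some i' then P i' else P0.
have Pk0 : Pk ord0 = P0 by rewrite /Pk unlift_none.
have PkS i : Pk (lift ord0 i) = P i by rewrite /Pk liftK.
exists Pk; split=> [i x Qx|i i'|i i'].
- case: (unliftP ord0 i) => [i' ->|->]; rewrite ?Pk0 ?PkS; last exact: QP0.
  exact/P0P/QP0.
- case: (unliftP ord0 i') => [i1 ->|->//]; rewrite PkS.
  case: (unliftP ord0 i) => [i0 ->|->]; rewrite ?Pk0 ?PkS //.
  by rewrite !lift0 ltnS; exact: Pmon.
- case: (unliftP ord0 i') => [i1 ->|->//]; rewrite PkS.
  case: (unliftP ord0 i) => [i0 ->|->]; rewrite ?Pk0 ?PkS.
    by rewrite !lift0 ltnS; exact: Pstr.
  by move=> _; exists (varB j c).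
Qed.

Lemma krull_dim_mod_ge (J : {set 'I_m}) (Q : set pol) :
  ideal_set Q -> free_mod J Q -> (#|J|%:R%:E <= krull_dim_mod R Q)%E.
Proof.
move=> Qid QJ; apply: ereal_sup_ubound; exists #|J| => //.
exact: free_mod_chain.
Qed.

End Chains.

(** * Counting grid points by the dimension *)

Section PointCount.
Variables (R : realType) (m : nat).
Local Notation pol := (mpoly m R).

Lemma vanishing_ideal_set (S : set ('I_m -> R)) :
  ideal_set (vanishing_ideal S).
Proof.
split=> [x Sx|a f g fS gS x Sx]; first by rewrite meval0.
by rewrite mevalD mevalM fS ?gS // mulr0 addr0.
Qed.

(** Setting the variables outside [J] to 0 leaves the values of [f] unchanged and kills the terms
    that [g] drops. *)
Lemma depends_on_supported (J : {set 'I_m}) (f : pol) : depends_on J f ->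
  exists g : pol, (forall x, meval x g = meval x f) /\
    (forall u, u \in msupp g -> supported J u).
Proof.
move=> fJ; pose P (u : multinom m) := [forall i, (i \notin J) ==> (u i == 0%N)].
exists (\sum_(u <- msupp f | P u) mcoeff u f *: mpolyX R u); split.
  move=> x; rewrite -(fJ (fun i => if i \in J then x i else 0)); last first.
    by move=> i ->.
  rewrite raddf_sum [RHS]mevalE [RHS](bigID P) /= [X in _ = _ + X]big1 ?addr0.
    apply: eq_bigr => u /forallP uP; rewrite mevalZ mevalX; congr (_ * _).
    apply: eq_bigr => i _; have := uP i.
    by case: ifP => //= _ /eqP ->; rewrite !expr0.
  move=> u; rewrite negb_forall => /existsP[j]; rewrite negb_imply.
  case/andP => jJ uj; rewrite (bigD1 j) //= (negPf jJ).
  by rewrite expr0n (negPf uj) mul0r mulr0.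
move=> u /msupp_sum_le/flattenP[s /mapP[v]].
rewrite mem_filter => /andP[/forallP vP _] -> /msuppZ_le.
by rewrite msuppX inE => /eqP -> i iJ; have /implyP/(_ iJ)/eqP := vP i.
Qed.

(** [J] is a largest set free modulo the vanishing ideal. The chains of primes bound [#|J|] by the
    dimension, and each larger set, not being free, carries the polynomial that [card_grid_points]
    asks for. *)
Lemma card_grid_points_dim (S : set ('I_m -> R)) : S !=set0 ->
  exists k C : nat, (k%:R%:E <= real_alg_dim S)%E /\
  forall (G : seq R) (T : finType) (p : T -> 'I_m -> R),
    (0 < size G)%N ->
    (forall a, S (p a)) -> (forall a i, p a i \in G) ->
    (forall a b, a != b -> exists i, p a i != p b i) ->
    (#|T| <= C * size G ^ k)%N.
Proof.
move=> [z Sz]; pose I := vanishing_ideal S.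
have free0 : `[< free_mod finset.set0 I >].
  apply/asboolP => f fI f0 x; rewrite -(fI z Sz); apply: f0 => i.
  by rewrite inE.
have [J /asboolP JI Jmax] :=
  @arg_maxnP _ _ (fun J => `[< free_mod J I >]) (fun J => #|J|) free0.
have [|C CP] := @card_grid_points R m S #|J|.
  move=> J' JJ'; have : ~ free_mod J' I.
    by move=> /asboolP/Jmax; rewrite /= leqNgt JJ'.
  move=> nfree; apply: contrapT => no; apply: nfree => f fI fJ x.
  apply/eqP/negPn/negP => fx; apply: no.
  have [g [gE gJ]] := depends_on_supported fJ.
  have g0 : g != 0 by apply: contraNneq fx => g0; rewrite -gE g0 meval0.
  exists g => //; split=> [y Sy|]; first by rewrite gE; exact: fI.
  exact/gJ/mlead_supp.
exists #|J|, C; split => //.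
exact: krull_dim_mod_ge (@vanishing_ideal_set S) JI.
Qed.

End PointCount.

Lemma powR_le_exp_exponent (R : realType) (c alpha : R) (C k : nat) :
  0 < c ->
  (forall n : nat, (0 < n)%N -> c * powR n%:R alpha <= (C * n ^ k)%:R) ->
  alpha <= k%:R.
Proof.
move=> c0 le_n; rewrite leNgt; apply/negP => ka.
pose b := alpha - k%:R; have b0 : 0 < b by rewrite subr_gt0.
(* For [n > M] the power [n ^ b] exceeds [C / c], while the hypothesis gives [c * n ^ b <= C]. The
   added 1 makes this strict and [M] positive. *)
pose M : R := powR (C%:R / c + 1) b^-1.
have M0 : 0 < M by rewrite powR_gt0 // ltr_wpDl // divr_ge0 // ltW.
pose n := (Num.truncn M).+1.
have Mn : M < n%:R by rewrite truncnS_gt.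
have n0 : 0 < n%:R :> R by rewrite ltr0n.
have := le_n n isT.
rewrite natrM natrX -[X in powR _ X](subrK k%:R) powRD; last first.
  by rewrite (gt_eqF n0) implybT.
rewrite powR_mulrn ?ler0n // mulrA ler_pM2r ?exprn_gt0 // -/b leNgt.
move/negP; apply; rewrite mulrC -ltr_pdivrMr //.
apply: (@lt_le_trans _ _ (C%:R / c + 1)); first by rewrite ltrDl ltr01.
have -> : C%:R / c + 1 = powR M b.
  by rewrite /M -powRrM mulVf ?gt_eqF // powRr1 // addr_ge0 // divr_ge0 // ltW.
by rewrite ge0_ler_powR // ?nnegrE ltW.
Qed.

(** * The Fourier decomposition of the periodic kernel *)

(** A free family of largest size in [S] spans it, since a vector outside the span would extend the
    family. Hence [vdim] is a true dimension and not the default of [xget]. *)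
Lemma exists_basis (K : fieldType) (E : lmodType K) (S : set E) (M : nat) :
  (forall p (v : 'I_p -> E), (forall i, S (v i)) ->
     (forall c : 'I_p -> K, \sum_i c i *: v i = 0 -> forall i, c i = 0) ->
     (p <= M)%N) ->
  exists v : 'I_(vdim S) -> E, is_basis S v.
Proof.
move=> bound; suff [n nP] : exists n, exists v : 'I_n -> E, is_basis S v.
  exact: (@xgetPex _ 0%N [set n | exists v : 'I_n -> E, is_basis S v]
    (ex_intro _ n nP)).
pose Q p := `[< exists v : 'I_p -> E, (forall i, S (v i)) /\
  (forall c : 'I_p -> K, \sum_i c i *: v i = 0 -> forall i, c i = 0) >].
have exQ : exists p, Q p.
  by exists 0%N; apply/asboolP; exists (fun=> 0); split=> [[]|c _ []].
have QM p : Q p -> (p <= M)%N.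
  by move=> /asboolP[v [vS vfree]]; exact: bound vfree.
have [n /asboolP[v [vS vfree]] nmax] := ex_maxnP exQ QM.
exists n, v; split=> // x Sx.
pose v' i := if unlift ord0 i is Some j then v j else x.
have v'0 : v' ord0 = x by rewrite /v' unlift_none.
have v'S i : v' (lift ord0 i) = v i by rewrite /v' liftK.
have : ~ Q n.+1 by move=> /nmax; rewrite ltnn.
move=> nQ; apply: contrapT => nspan; apply: nQ; apply/asboolP.
exists v'; split=> [i|c].
  by case: (unliftP ord0 i) => [j ->|->]; rewrite ?v'S ?v'0.
rewrite big_ord_recl v'0; under eq_bigr do rewrite v'S.
move=> c_rel; have [c0|c0] := eqVneq (c ord0) 0.
  move: c_rel; rewrite c0 scale0r add0r => /vfree cS i.
  by case: (unliftP ord0 i) => [j ->|->].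
exfalso; apply: nspan; exists (fun i => - ((c ord0)^-1 * c (lift ord0 i))).
move/eqP: c_rel; rewrite addr_eq0 => /eqP/(congr1 (fun y => (c ord0)^-1 *: y)).
rewrite scalerA mulVf // scale1r => ->; rewrite scalerN scaler_sumr -sumrN.
by apply: eq_bigr => i _; rewrite scalerA scaleNr.
Qed.

Lemma sum_expr_eq0 (K : idomainType) (x : K) n :
  x ^+ n = 1 -> x != 1 -> \sum_(l < n) x ^+ l = 0.
Proof.
move=> xn x1; apply: (mulfI (x := x - 1)); first by rewrite subr_eq0.
by rewrite -subrX1 xn subrr mulr0.
Qed.

Section RootOfUnity.
Variable R : realType.
Local Notation cis t := (Complex (cos t) (sin t) : R[i]).

Lemma cis_expr (t : R) k : cis t ^+ k = cis (t *+ k).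
Proof.
elim: k => [|k IH]; first by rewrite expr0 mulr0n cos0 sin0.
rewrite exprS IH mulrS cosD sinD; apply/eqP; rewrite eq_complex /=.
by rewrite !eqxx /= addrC [X in X + _]mulrC [X in _ + X]mulrC eqxx.
Qed.

Lemma norm_cis (t : R) : `|cis t| = 1.
Proof. by rewrite normc_def /= cos2Dsin2 sqrtr1. Qed.

Lemma prim_root_cis n : (0 < n)%N ->
  n.-primitive_root (cis (2 * pi / n%:R)).
Proof.
move=> n0; have n0R : n%:R != 0 :> R by rewrite pnatr_eq0 -lt0n.
apply/andP; split=> //; apply/forallP => -[j /= jn].
rewrite unity_rootE cis_expr; have [->|jn'] := eqVneq j.+1 n.
  rewrite -[_ *+ n]mulr_natr mulfVK // eqb_id mulr_natl.
  by rewrite eq_complex /= cos2pi sin2pi !eqxx.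
have {}jn : (j.+1 < n)%N by rewrite ltn_neqAle jn' jn.
rewrite eqbF_neg; apply/negP; rewrite eq_complex /= => /andP[/eqP + _].
(* Half of this angle lies strictly between 0 and pi, so its sine is positive, while a cosine of 1
   at the whole angle would make that sine zero. *)
have -> : 2 * pi / n%:R *+ j.+1 = (pi * (j.+1%:R / n%:R)) *+ 2 :> R.
  by rewrite -[_ *+ j.+1]mulr_natr -[RHS]mulr_natl; ring.
set x := pi * _; have : 0 < sin x.
  apply: sin_gt0_pi; rewrite /x mulr_gt0 ?pi_gt0 ?divr_gt0 ?ltr0n //=.
  by rewrite gtr_pMr ?pi_gt0 // ltr_pdivrMr ?ltr0n // mul1r ltr_nat.
rewrite cos_mulr2n => s0 cx; have := cos2Dsin2 x.
have -> : cos x ^+ 2 = 1 by lra.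
by have := exprn_gt0 2 s0; lra.
Qed.

End RootOfUnity.

Section FourierProjection.
Variables (R : realType) (d : nat) (F : crystal_framework R d).
Local Notation C := R[i].

Lemma position_vshift v (x : vertex d (motif_size F)) :
  position (vshift v x) = position x + \sum_i (v 0 i)%:~R *: row i (lattice F).
Proof.
rewrite /position /translate /= -addrA; congr (_ + _); rewrite -big_split.
by apply: eq_bigr => i _; rewrite mxE intrD scalerDl.
Qed.

(** Translating an edge does not change the vector between its ends. *)
Lemma rigidity_vshift (K : fieldType) (iota : {rmorphism R -> K})
    (u : displacement F K) v e k :
  rigidity iota (fun x => u (vshift v x)) (e, k) = rigidity iota u (e, k + v).
Proof.
rewrite /rigidity /=; apply: eq_bigr => s _.
have vD nv (x : vertex d nv) : vshift (k + v) x = vshift v (vshift k x).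
  by rewrite /vshift /= addrA.
have posB v' (x y : vertex d (motif_size F)) :
    position (vshift v' x) - position (vshift v' y) = position x - position y.
  by rewrite !position_vshift opprD addrACA subrr addr0.
by rewrite /eshift /= !vD !posB.
Qed.

Lemma rigidity_sum (K : fieldType) (iota : {rmorphism R -> K}) (I : finType)
    (c : I -> K) (u : I -> displacement F K) b :
  rigidity iota (fun x => \sum_i c i *: u i x) b =
  \sum_i c i * rigidity iota (u i) b.
Proof.
rewrite /rigidity /=; under [RHS]eq_bigr do rewrite mulr_sumr.
rewrite exchange_big; apply: eq_bigr => s _ /=.
rewrite !summxE -sumrB mulr_sumr; apply: eq_bigr => i _.
by rewrite !mxE -mulrBr mulrCA.
Qed.

Definition chr (w : 'rV[C]_d) (k : 'rV[int]_d) : C :=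
  \prod_i w 0 i ^ k 0 i.

Implicit Types w : 'rV[C]_d.

Lemma chr_neq0 w k : (forall i, w 0 i != 0) -> chr w k != 0.
Proof. by move=> w0; apply/prodf_neq0 => i _; rewrite expfz_neq0. Qed.

Lemma chrD w k l : (forall i, w 0 i != 0) ->
  chr w (k + l) = chr w k * chr w l.
Proof.
move=> w0; rewrite /chr -big_split; apply: eq_bigr => i _.
by rewrite mxE expfzDr.
Qed.

Variables (n : nat) (n_gt0 : (0 < n)%N).
Local Notation box := {ffun 'I_d -> 'I_n}.

Definition torsion (w : 'rV[C]_d) := forall i, w 0 i ^+ n = 1.

Lemma torsion_neq0 w : torsion w -> forall i, w 0 i != 0.
Proof.
move=> wn i; apply: contra_eq_neq (wn i) => ->.
by rewrite expr0n eqn0Ngt n_gt0 /= eq_sym oner_neq0.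
Qed.

Lemma chr_period w (m : 'rV[int]_d) : torsion w ->
  (forall i, (n%:Z %| m 0%R i)%Z) -> chr w m = 1.
Proof.
move=> wn nm; apply: big1 => i _.
have /dvdzP[q ->] := nm i; rewrite mulrC -exprz_exp.
by rewrite -exprnP wn exp1rz.
Qed.

Definition ivec (l : box) : 'rV[int]_d := \row_i (l i : nat)%:Z.

Lemma chr_ivec w l : chr w (ivec l) = \prod_i w 0 i ^+ l i.
Proof. by apply: eq_bigr => i _; rewrite mxE. Qed.

(** The sum over the box factors into geometric sums, one per coordinate, and one with ratio
    [w 0 i != 1] vanishes. *)
Lemma sum_chr_eq0 w : torsion w -> w != const_mx 1 ->
  \sum_(l : box) chr w (ivec l) = 0.
Proof.
move=> wn w1; have [i wi] : exists i, w 0 i != 1.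
  apply: contrapT => /forallNP no; case/negP: w1; apply/eqP/rowP => i.
  by rewrite mxE; apply/eqP/negPn/negP/no.
under eq_bigr do rewrite chr_ivec.
rewrite -(bigA_distr_bigA (fun i (j : 'I_n) => w 0 i ^+ j)) (bigD1 i) //=.
by rewrite sum_expr_eq0 ?mul0r.
Qed.

Lemma sum_chr1 : \sum_(l : box) chr (const_mx 1) (ivec l) = #|{: box}|%:R.
Proof.
rewrite -sumr_const; apply: eq_bigr => l _; apply: big1 => i _.
by rewrite mxE exp1rz.
Qed.

Lemma card_box_neq0 : #|{: box}|%:R != 0 :> C.
Proof. by rewrite pnatr_eq0 card_ffun !card_ord -lt0n expn_gt0 n_gt0. Qed.

(** Up to the factor [n ^ d], the projection of [n]-periodic displacements onto the phase-periodic
    ones for a torsion point [w]. *)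
Definition proj w (u : displacement F C) : displacement F C :=
  fun x => \sum_(l : box) (chr w (ivec l))^-1 *: u (vshift (ivec l) x).

Lemma proj_sum w (I : finType) (c : I -> C) (u : I -> displacement F C) x :
  proj w (fun y => \sum_i c i *: u i y) x = \sum_i c i *: proj w (u i) x.
Proof.
rewrite /proj; under eq_bigr do rewrite scaler_sumr.
rewrite exchange_big; apply: eq_bigr => i _ /=.
by rewrite scaler_sumr; apply: eq_bigr => l _; rewrite !scalerA mulrC.
Qed.

Lemma rigidity_proj iota w (u : displacement F C) :
  (forall b, rigidity iota u b = 0) -> forall b, rigidity iota (proj w u) b = 0.
Proof.
move=> u0 [e k]; rewrite rigidity_sum big1 // => l _.
by rewrite rigidity_vshift u0 mulr0.
Qed.

(** Adding [k] permutes the classes modulo [n], and [h] is this permutation on their representatives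
    in the box. *)
Lemma sum_box_shift (V : nmodType) (g : 'rV[int]_d -> V) k :
  (forall m v : 'rV[int]_d, (forall i, (n%:Z %| m 0%R i)%Z) -> g (v + m) = g v) ->
  \sum_(l : box) g (k + ivec l) = \sum_(l : box) g (ivec l).
Proof.
move=> g_per.
have r_lt (l : box) i : (`|((k 0%R i + (l i : nat)%:Z) %% n%:Z)%Z| < n)%N.
  by rewrite -ltz_nat gez0_abs ?modz_ge0 ?ltz_pmod // ?gt_eqF // ltz_nat.
have r_abs (l : box) i : `|((k 0%R i + (l i : nat)%:Z) %% n%:Z)%Z|%N%:Z
    = ((k 0%R i + (l i : nat)%:Z) %% n%:Z)%Z.
  by rewrite gez0_abs // modz_ge0 // gt_eqF // ltz_nat.
pose h (l : box) : box := [ffun i => Ordinal (r_lt l i)].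
have h_inj : injective h.
  move=> l l' hl; apply/ffunP => i; apply/val_inj.
  have := congr1 (fun f : box => (f i : nat)%:Z) hl.
  rewrite !ffunE /= !r_abs => /eqP; rewrite eqz_modDl.
  by rewrite !modz_small ?lez_nat ?ltz_nat ?ltn_ord // eqz_nat => /eqP.
rewrite [RHS](reindex_inj h_inj); apply: eq_bigr => l _.
pose m : 'rV[int]_d := \row_i (((k 0%R i + (l i : nat)%:Z) %/ n%:Z)%Z * n%:Z).
rewrite -[RHS](g_per m) => [|i]; last by rewrite mxE dvdz_mull.
congr g; apply/rowP => i; rewrite !mxE ffunE /= r_abs.
by rewrite [RHS]addrC -divz_eq.
Qed.

(** The summand [g] is [n]-periodic, so the sum may be shifted by [k], which releases the factor
    [chr w k]. *)
Lemma proj_phase w (u : displacement F C) : torsion w ->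
  Defs.periodic (fun=> n) u -> phase_periodic w (proj w u).
Proof.
move=> wn u_per kappa k; have w0 := torsion_neq0 wn.
pose g v := (chr w v)^-1 *: u (kappa, v).
have g_per (m v : 'rV[int]_d) : (forall i, (n%:Z %| m 0%R i)%Z) -> g (v + m) = g v.
  by move=> nm; rewrite /g chrD // (chr_period wn nm) mulr1 u_per.
rewrite -/(chr w k) /proj /vshift /=.
have -> : \sum_(l : box) (chr w (ivec l))^-1 *: u (kappa, 0 + ivec l) =
    \sum_(l : box) g (ivec l).
  by apply: eq_bigr => l _; rewrite add0r.
rewrite -(sum_box_shift k g_per) scaler_sumr; apply: eq_bigr => l _.
by rewrite /g scalerA chrD // invfM mulrA divff ?mul1r // chr_neq0.
Qed.

Lemma phase_periodicD w (u : displacement F C) x l : (forall i, w 0 i != 0) ->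
  phase_periodic w u -> u (vshift l x) = chr w l *: u x.
Proof.
case: x => kappa k w0 wu; rewrite /vshift /= wu [in RHS]wu scalerA.
by rewrite -![\prod_i _]/(chr w _) chrD // mulrC.
Qed.

Lemma phase_periodic_torsion w (u : displacement F C) : torsion w ->
  phase_periodic w u -> Defs.periodic (fun=> n) u.
Proof.
move=> wn wu m nm kappa k.
have := phase_periodicD (kappa, k) m (torsion_neq0 wn) wu.
by rewrite (chr_period wn nm) scale1r.
Qed.

(** Orthogonality of characters: on such [u] the operator [proj w] multiplies by the sum of the
    quotient character [q] over the box. *)
Lemma proj_phase_eq w w' (u : displacement F C) x : torsion w -> torsion w' ->
  phase_periodic w' u ->
  proj w u x = (if w == w' then #|{: box}|%:R else 0) *: u x.
Proof.
move=> wn wn' wu; have w0 := torsion_neq0 wn; have w0' := torsion_neq0 wn'.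
pose q : 'rV[C]_d := \row_i (w' 0 i / w 0 i).
have -> : proj w u x = (\sum_(l : box) chr q (ivec l)) *: u x.
  rewrite scaler_suml; apply: eq_bigr => l _.
  rewrite (phase_periodicD _ _ w0' wu) scalerA !chr_ivec -prodfV -big_split.
  congr (_ *: _); apply: eq_bigr => i _.
  by rewrite mxE expr_div_n /= mulrC.
have q1 : (q == const_mx 1) = (w == w').
  apply/eqP/eqP => [/rowP qE|ww'].
    apply/rowP => i; have := qE i; rewrite !mxE => /(canRL (mulfVK (w0 i))).
    by rewrite mul1r.
  by apply/rowP => i; rewrite !mxE ww' divff.
rewrite -q1; have [->|q1'] := eqVneq q (const_mx 1); first by rewrite sum_chr1.
rewrite sum_chr_eq0 //.
by move=> i; rewrite mxE expr_div_n wn wn' divff ?oner_neq0.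
Qed.

Local Notation zeta :=
  (Complex (cos (2 * pi / n%:R)) (sin (2 * pi / n%:R)) : C).

Definition grid_point (k : box) : 'rV[C]_d := \row_i zeta ^+ k i.

Lemma grid_point_torsion k : torsion (grid_point k).
Proof.
by move=> i; rewrite mxE exprAC (prim_expr_order (prim_root_cis R n_gt0)) expr1n.
Qed.

Lemma grid_point_torus k : torus (grid_point k).
Proof. by move=> i; rewrite mxE normrX norm_cis expr1n. Qed.

Lemma torus_gridE : torus_grid R (fun=> n) = range grid_point.
Proof.
have zetaE (j : nat) : zeta ^+ j =
    Complex (cos (2 * pi * j%:R / n%:R)) (sin (2 * pi * j%:R / n%:R)).
  by rewrite cis_expr -[_ *+ j]mulr_natr mulrAC.
apply/seteqP; split => [w [k kn wE]|_ [k _ <-]].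
  exists [ffun i => Ordinal (kn i)] => //; apply/rowP => i.
  by rewrite wE mxE ffunE /= zetaE.
by exists (fun i => k i) => // i /=; rewrite mxE zetaE.
Qed.

(** Fourier inversion: after exchanging the sums, the coefficient of the shift by [l] is a full
    character sum, which vanishes unless [l] is 0. *)
Lemma sum_proj (u : displacement F C) x :
  \sum_(k : box) proj (grid_point k) u x = #|{: box}|%:R *: u x.
Proof.
rewrite /proj exchange_big /=; pose l0 : box := [ffun=> Ordinal n_gt0].
have prim := prim_root_cis R n_gt0.
pose q (l : box) : 'rV[C]_d := \row_i (zeta ^+ l i)^-1.
have zeta0 (j : nat) : zeta ^+ j != 0.
  by rewrite expf_neq0 // -normr_gt0 norm_cis ltr01.
have qE l : \sum_(k : box) (chr (grid_point k) (ivec l))^-1 =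
    \sum_(k : box) chr (q l) (ivec k).
  apply: eq_bigr => k _; rewrite !chr_ivec -prodfV; apply: eq_bigr => i _.
  by rewrite !mxE exprVn exprAC.
have qn l : torsion (q l).
  by move=> i; rewrite mxE exprVn exprAC (prim_expr_order prim) expr1n invr1.
rewrite (bigD1 l0) //= [X in _ + X]big1 ?addr0 => [|l ll0].
  rewrite -scaler_suml qE; have -> : q l0 = const_mx 1.
    by apply/rowP => i; rewrite !mxE ffunE /= expr0 invr1.
  rewrite sum_chr1 /vshift; have -> : ivec l0 = 0.
    by apply/rowP => i; rewrite !mxE ffunE.
  by rewrite addr0; case: x.
rewrite -scaler_suml qE sum_chr_eq0 ?scale0r //.
apply: contra ll0 => /eqP/rowP ql; apply/eqP/ffunP => i; apply/val_inj.
have : zeta ^+ l i == zeta ^+ 0.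
  by rewrite expr0 -invr_eq1; have := ql i; rewrite !mxE => ->.
by rewrite (eq_prim_root_expr prim) mod0n modn_small // ffunE => /eqP.
Qed.

End FourierProjection.

(** * The two bounds on the nullity *)

Section NullityBounds.
Variables (R : realType) (d : nat) (F : crystal_framework R d).
Variables (n : nat) (n_gt0 : (0 < n)%N).
Local Notation C := R[i].
Local Notation box := {ffun 'I_d -> 'I_n}.
Local Notation V := (vertex d (motif_size F)).
Local Notation rigC := (@rigidity R d F C (real_complex R)).
Local Notation rigR := (@rigidity R d F R idfun).
Local Notation Omega_n := (RUM_spectrum F `&` torus_grid R (fun=> n)).
Local Notation ker := (periodic_kernel F (fun=> n)).

Definition complexify (v : V -> 'rV[R]_d) : displacement F C :=
  fun x => map_mx (real_complex R) (v x).

Definition periodic_kernelC : set (displacement F C) :=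
  [set u | Defs.periodic (fun=> n) u /\ forall b, rigC u b = 0].

Lemma complexify_kernel v : ker v -> periodic_kernelC (complexify v).
Proof.
move=> [v_per v0]; split=> [m nm kappa k|b].
  by rewrite /complexify v_per.
rewrite -[RHS](rmorph0 (real_complex R)) -(v0 b) /rigidity rmorph_sum.
apply: eq_bigr => s _; rewrite rmorphM rmorphB.
by congr (_ * (_ - _)); rewrite mxE.
Qed.

(** The rigidity matrix is real, so it commutes with every R-linear [f]; this serves for both the
    real and the imaginary part. *)
Lemma part_kernel (f : {additive C -> R}) :
  (forall (a : R) (z : C), f (real_complex R a * z) = a * f z) ->
  forall u, periodic_kernelC u -> ker (fun x => map_mx f (u x)).
Proof.
move=> fZ u [u_per u0]; split=> [m nm kappa k|b]; first by rewrite u_per.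
rewrite -[RHS](raddf0 f) -(u0 b) /rigidity raddf_sum.
apply: eq_bigr => s _; rewrite fZ raddfB.
by congr (_ * (_ - _)); rewrite mxE.
Qed.

Lemma Re_kernel u : periodic_kernelC u ->
  ker (fun x => map_mx (@complex.Re R) (u x)).
Proof.
by apply: part_kernel => a [x y] /=; rewrite mul0r subr0.
Qed.

Lemma Im_kernel u : periodic_kernelC u ->
  ker (fun x => map_mx (@complex.Im R) (u x)).
Proof.
by apply: part_kernel => a [x y] /=; rewrite mul0r addr0.
Qed.

Definition freeR (I : finType) (v : I -> V -> 'rV[R]_d) :=
  forall c : I -> R, \sum_i c i *: v i = 0 -> forall i, c i = 0.

Definition freeC (I : finType) (w : I -> displacement F C) :=
  forall c : I -> C, (forall x, \sum_i c i *: w i x = 0) -> forall i, c i = 0.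

Lemma freeC_complexify (I : finType) (v : I -> V -> 'rV[R]_d) :
  freeR v -> freeC (fun i => complexify (v i)).
Proof.
move=> vfree c c0.
have part (f : {additive C -> R}) :
    (forall (z : C) (a : R), f (z * real_complex R a) = f z * a) ->
    forall i, f (c i) = 0.
  move=> fZ; apply: vfree; apply/funext => x; rewrite fct_sumE.
  apply/rowP => s; have := congr1 (fun y : 'rV_d => f (y 0 s)) (c0 x).
  rewrite !summxE !mxE raddf_sum raddf0 => e; rewrite -[RHS]e.
  apply: eq_bigr => i _.
  by rewrite !mxE fZ.
move=> i; apply/eqP; rewrite eq_complex; apply/andP; split; apply/eqP.
  by apply: part => -[x y] a /=; rewrite mulr0 subr0.
by apply: part => -[x y] a /=; rewrite mulr0 add0r.
Qed.

Lemma Omega_n_finite : finite_set Omega_n.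
Proof.
apply: (@sub_finite_set _ _ (torus_grid R (fun=> n))); first exact: subIsetr.
by rewrite (torus_gridE R d n); apply: finite_image; exact: finite_finset.
Qed.

Lemma periodic_kernelC_sum (I : finType) (c : I -> C)
    (w : I -> displacement F C) :
  (forall i, periodic_kernelC (w i)) ->
  periodic_kernelC (fun x => \sum_i c i *: w i x).
Proof.
move=> wker; split=> [m nm kappa k|b].
  by apply: eq_bigr => i _; have [-> //] := wker i.
by rewrite rigidity_sum big1 // => i _; have [_ ->] := wker i; rewrite mulr0.
Qed.

Lemma proj_phase_kernel w (u : displacement F C) :
  torsion n w -> periodic_kernelC u -> phase_kernel F w (proj n w u).
Proof.
move=> wn [u_per u0]; split; first exact: proj_phase.
exact: rigidity_proj.
Qed.

(** The coordinates are the values at the motif vertices of the projections to the grid points of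
    the spectrum. If they vanish, so does every projection: by phase periodicity on the spectrum,
    and off it because the phase kernel is trivial. Fourier inversion then makes the vector zero. *)
Lemma card_free_le (p : nat) (v : 'I_p -> V -> 'rV[R]_d) :
  (forall i, ker (v i)) -> freeR v ->
  (p <= d * motif_size F * #|` fset_set Omega_n|)%N.
Proof.
move=> vker vfree; set A := fset_set _.
pose w i := complexify (v i).
have wker i : periodic_kernelC (w i) by exact: complexify_kernel.
have -> : (d * motif_size F * #|` A|)%N = #|{: 'I_d * 'I_(motif_size F) * A}|.
  by rewrite !card_prod !card_ord cardfE.
rewrite -[leqLHS]card_ord.
apply: (@leq_card_coords C _ ('I_d * 'I_(motif_size F) * A)%type (fun i t =>
  proj n (val t.2) (w i) (t.1.2, 0) 0 t.1.1)) => c c0.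
apply: (freeC_complexify vfree) => x.
pose u : displacement F C := fun x => \sum_i c i *: w i x.
have uker : periodic_kernelC u by exact: periodic_kernelC_sum.
have proj0 (k : box) y : proj n (grid_point R k) u y = 0.
  set om := grid_point R k.
  have ker_om := proj_phase_kernel (grid_point_torsion R n_gt0 k) uker.
  have [om_RUM|om_nRUM] := pselect (RUM_spectrum F om); last first.
    apply: contrapT => y0; apply: om_nRUM; split; first exact: grid_point_torus.
    by exists (proj n om u) => //; exists y.
  have omA : om \in A.
    rewrite in_fset_set; last exact: Omega_n_finite.
    by apply/mem_set; split=> //; rewrite (torus_gridE R d n); exists k.
  case: y => kappa l; have [-> _] := ker_om.
  suff -> : proj n om u (kappa, 0) = 0 by rewrite scaler0.
  apply/rowP => s; rewrite mxE proj_sum summxE.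
  rewrite -[RHS](c0 (s, kappa, [` omA])%fset); apply: eq_bigr => i _.
  by rewrite mxE.
have := sum_proj n_gt0 u x; rewrite big1 => [/esym/eqP|k _]; last exact: proj0.
by rewrite scaler_eq0 (negPf (card_box_neq0 R d n_gt0)) => /eqP.
Qed.

Lemma vdim_basis : exists v : 'I_(vdim ker) -> V -> 'rV[R]_d, is_basis ker v.
Proof. exact: exists_basis card_free_le. Qed.

Lemma vdim_ker_le : (vdim ker <= d * motif_size F * #|` fset_set Omega_n|)%N.
Proof. by have [v [vker vfree _]] := vdim_basis; exact: card_free_le vfree. Qed.

(** The complexification of a real basis spans the complex kernel, as seen on real and imaginary
    parts. *)
Lemma card_freeC_le (I : finType) (w : I -> displacement F C) :
  (forall i, periodic_kernelC (w i)) -> freeC w -> (#|I| <= vdim ker)%N.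
Proof.
move=> wker wfree; have [v [vker vfree vspan]] := vdim_basis.
have coords i : exists c : 'I_(vdim ker) -> C,
    forall x, w i x = \sum_j c j *: complexify (v j) x.
  have [a aE] := vspan _ (Re_kernel (wker i)).
  have [b bE] := vspan _ (Im_kernel (wker i)).
  exists (fun j => Complex (a j) (b j)) => x; apply/rowP => s.
  have /(congr1 (fun y : 'rV_d => y 0 s)) := congr1 (fun f => f x) aE.
  have /(congr1 (fun y : 'rV_d => y 0 s)) := congr1 (fun f => f x) bE.
  rewrite !fct_sumE !summxE !mxE => imE reE; apply/eqP.
  rewrite eq_complex !raddf_sum imE reE /=.
  apply/andP; split; apply/eqP; apply: eq_bigr => j _; rewrite !mxE /=.
    by rewrite mulr0 subr0.
  by rewrite mulr0 add0r.
have {coords} /choice[phi phiE] := coords.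
rewrite -[leqRHS]card_ord; apply: (@leq_card_coords C _ _ phi) => c c0.
apply: wfree => x; under eq_bigr do rewrite phiE scaler_sumr.
rewrite exchange_big big1 //= => j _.
under eq_bigr do rewrite scalerA.
by rewrite -scaler_suml c0 scale0r.
Qed.

Definition translation (s : 'I_d) : displacement F C := fun=> delta_mx 0 s.

Lemma translation_phase_kernel s : phase_kernel F (const_mx 1) (translation s).
Proof.
split=> [kappa k|b].
  by rewrite big1 ?scale1r // => i _; rewrite mxE exp1rz.
by rewrite /rigidity big1 // => j _; rewrite subrr mulr0.
Qed.

(** Each point of [A] contributes a nonzero vector of its phase kernel. The point 1 contributes the
    translation along [s0] in this way, and [d - 1] further ones along the other axes. *)
Lemma leq_vdim_ker : (0 < d)%N ->
  (d - 1 + #|` fset_set Omega_n| <= vdim ker)%N.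
Proof.
move=> d_gt0; set A := fset_set _; pose s0 := Ordinal d_gt0.
have A_RUM (a : A) : Omega_n (val a).
  have := valP a; rewrite in_fset_set; last exact: Omega_n_finite.
  exact: set_mem.
have A_torsion (a : A) : torsion n (val a).
  have [_] := A_RUM a; rewrite (torus_gridE R d n) => -[k _ <-].
  exact: grid_point_torsion.
have /choice[e eP] : forall a : A, exists u : displacement F C,
    [/\ phase_kernel F (val a) u, exists x, u x <> 0
      & val a = const_mx 1 -> u = translation s0].
  move=> a; have [a1|a1] := eqVneq (val a) (const_mx 1).
    exists (translation s0); rewrite a1; split=> //.
      exact: translation_phase_kernel.
    exists (Ordinal (motif_size_gt0 F), 0) => /rowP/(_ s0).
    by rewrite !mxE !eqxx => /eqP; rewrite oner_eq0.
  have [[_ [u uker u0]] _] := A_RUM a.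
  by exists u; split=> // a1'; rewrite a1' eqxx in a1.
pose I : finType := ({s : 'I_d | s != s0} + A)%type.
have <- : #|{: I}| = (d - 1 + #|` A|)%N.
  by rewrite card_sum card_sig cardC1 card_ord subn1 cardfE.
pose om (i : I) : 'rV[C]_d := if i is inr a then val a else const_mx 1.
pose w (i : I) := match i with inl s => translation (val s) | inr a => e a end.
have om_torsion i : torsion n (om i).
  by case: i => [s|a] /=; [move=> i; rewrite mxE expr1n|exact: A_torsion].
have wP i : phase_kernel F (om i) (w i).
  by case: i => [s|a]; [exact: translation_phase_kernel|case: (eP a)].
apply: (@card_freeC_le I w) => [i|c c0].
  have [w_ph w_rig] := wP i; split=> //.
  exact: phase_periodic_torsion (om_torsion i) w_ph.
have c_om z x : torsion n z -> \sum_(i | om i == z) c i *: w i x = 0.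
  move=> zn; have : proj n z (fun y => \sum_i c i *: w i y) x = 0.
    by rewrite /proj big1 // => l _; rewrite c0 scaler0.
  rewrite proj_sum [in X in _ -> X]big_mkcond => proj0.
  apply: (scalerI (card_box_neq0 R d n_gt0)).
  rewrite scaler0 -[RHS]proj0 scaler_sumr; apply: eq_bigr => i _.
  have [w_ph _] := wP i.
  rewrite (proj_phase_eq n_gt0 x zn (om_torsion i) w_ph) eq_sym.
  by case: eqP => _; rewrite ?scale0r ?scaler0 // !scalerA mulrC.
have one_torsion : torsion n (const_mx 1 : 'rV[C]_d).
  by move=> i; rewrite mxE expr1n.
(* The part of the relation at a point other than 1 has a single term; at 1 its terms are
   translations along different axes, recorded by [dir]. *)
move=> i; have [om1|om1] := eqVneq (om i) (const_mx 1); last first.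
  case: i om1 => [s|a] om1; first by rewrite eqxx in om1.
  have [_ [x ex] _] := eP a; have := c_om _ x (A_torsion a).
  rewrite (bigD1 (inr a)) /= ?eqxx // big1 ?addr0 => [/eqP|j].
    by rewrite scaler_eq0 => /orP[/eqP//|/eqP].
  case/andP => /eqP oma; case: j oma => [s|b] /= oma.
    by move: om1; rewrite /= -oma eqxx.
  by rewrite (val_inj oma) eqxx.
pose dir (j : I) := match j with inl s => val s | inr _ => s0 end.
have wE j : om j == const_mx 1 -> w j = translation (dir j).
  by case: j => [//|b] /= /eqP ob; case: (eP b) => _ _ /(_ ob).
have dir_inj j : om j == const_mx 1 -> j != i -> dir i != dir j.
  case: i j om1 => [s|a] [t|b] /= oma omb.
  - by apply: contra => /eqP/val_inj ->.
  - by move=> _; exact: (valP s).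
  - by move=> _; rewrite eq_sym; exact: (valP t).
  - by case/eqP; congr inr; apply/val_inj; rewrite /= oma; apply/eqP.
have := c_om _ (Ordinal (motif_size_gt0 F), 0) one_torsion.
move=> /rowP/(_ (dir i)); rewrite summxE (bigD1 i) /= ?om1 //.
rewrite [X in _ + X]big1 ?addr0 => [|j /andP[j1 ji]].
  by rewrite wE ?om1 // !mxE !eqxx mulr1.
by rewrite wE // !mxE eqxx (negPf (dir_inj _ j1 ji)) mulr0.
Qed.

End NullityBounds.

(** * The spectrum on the torsion grid *)

Lemma RUM_spectrum1 (R : realType) (d : nat) (F : crystal_framework R d) :
  (0 < d)%N -> RUM_spectrum F (const_mx 1).
Proof.
move=> d_gt0; pose s := Ordinal d_gt0.
split; first by move=> i; rewrite mxE normr1.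
exists (@translation R d F s); first exact: translation_phase_kernel.
exists (Ordinal (motif_size_gt0 F), 0) => /rowP/(_ s).
by rewrite !mxE !eqxx => /eqP; rewrite oner_eq0.
Qed.

Lemma card_RUM_grid_le (R : realType) (d : nat) (F : crystal_framework R d) :
  (0 < d)%N ->
  exists k C : nat, (k%:R%:E <= RUM_dim F)%E /\ forall n : nat, (0 < n)%N ->
    (#|` fset_set (RUM_spectrum F `&` torus_grid R (fun=> n))|
      <= C * n ^ k)%N.
Proof.
move=> d_gt0; have [|k [C [dimk CP]]] :=
    @card_grid_points_dim R (d + d) [set real_coords w | w in RUM_spectrum F].
  by exists (real_coords (const_mx 1)), (const_mx 1) => //; exact: RUM_spectrum1.
exists k, (C * 2 ^ k)%N; split=> // n n_gt0; set A := fset_set _.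
have A_Omega (a : A) :
    RUM_spectrum F (val a) /\ torus_grid R (fun=> n) (val a).
  have := valP a; rewrite in_fset_set; last exact: Omega_n_finite.
  exact: set_mem.
pose theta (j : nat) : R := 2 * pi * j%:R / n%:R.
(* Every real coordinate of a grid point is among these [2 * n] cosines and sines, whence the factor
   [2 ^ k] in the constant. *)
pose G := [seq cos (theta j) | j <- iota 0 n] ++
          [seq sin (theta j) | j <- iota 0 n].
have sizeG : size G = (2 * n)%N.
  by rewrite size_cat !size_map size_iota mul2n addnn.
rewrite -mulnA -expnMn -sizeG cardfE.
apply: (CP G A (fun a => real_coords (val a))) => [|a|a i|a b ab].
- by rewrite sizeG muln_gt0.
- by exists (val a) => //; case: (A_Omega a).
- have [_ [j jn aE]] := A_Omega a; rewrite /real_coords mxE mem_cat.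
  case: splitP => i' _; rewrite mxE aE /=.
    by apply/orP; left; apply/mapP; exists (j i'); rewrite // mem_iota add0n jn.
  by apply/orP; right; apply/mapP; exists (j i'); rewrite // mem_iota add0n jn.
- apply: contrapT => /forallNP same; case/eqP: ab; apply/val_inj/rowP => i.
  have {}same j : real_coords (val a) j = real_coords (val b) j.
    by apply/eqP/negPn/negP/same.
  apply/eqP; rewrite eq_complex; apply/andP; split; apply/eqP.
    by have := same (lshift d i); rewrite /real_coords !row_mxEl !mxE.
  by have := same (rshift d i); rewrite /real_coords !row_mxEr !mxE.
Qed.

Theorem theorem4p2 (R : realType) (d : nat) (hd : (0 < d)%N)
    (F : crystal_framework R d) :
  let nu := fun n : nat => vdim (periodic_kernel F (fun=> n)) in
  let N := fun n : nat =>
    #|` fset_set (RUM_spectrum F `&` torus_grid R (fun=> n)) |%fset in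
  (forall n : nat, (0 < n)%N ->
     (d - 1 + N n <= nu n)%N /\ (nu n <= d * motif_size F * N n)%N) /\
  (forall c alpha : R, 0 < c -> 0 < alpha ->
     (forall n : nat, (0 < n)%N -> c * powR n%:R alpha <= (nu n)%:R) ->
     (alpha%:E <= RUM_dim F)%E).
Proof.
move=> nu N; split=> [n n_gt0|c alpha c_gt0 _ le_nu].
  by split; [exact: leq_vdim_ker|exact: vdim_ker_le].
(* The upper bound of (i) gives [c n^alpha <= d |F_v| C n^k] for all positive [n], so [alpha <= k],
   and [k] is at most the dimension of the spectrum. *)
have [k [C [dimk NC]]] := card_RUM_grid_le F hd.
apply: le_trans dimk; rewrite lee_fin.
apply: (@powR_le_exp_exponent _ c alpha (d * motif_size F * C)) => // n n_gt0.
apply: le_trans (le_nu n n_gt0) _; rewrite ler_nat.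
apply: leq_trans (vdim_ker_le F n_gt0) _.
by rewrite -[leqRHS]mulnA leq_mul2l NC ?orbT.
Qed.
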